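(* Let $0<\mu<L$ and $N\ge1$. For the prefix-exact Chebyshev recurrence with horizon $N$, the first-variation kernel satisfies, for all $\lambda,\nu\in[\mu,L]$, $$K_0^{\rm pref}(\lambda,\nu)=-\frac{2}{\Delta T_N(\eta)}U_{N-1}(z(\lambda)),$$ and, for $1\le s\le N-1$, $$K_s^{\rm pref}(\lambda,\nu)=-\frac{4}{\Delta T_N(\eta)}U_{N-s-1}(z(\lambda))\,T_s(z(\nu)).$$ Consequently $$A_N^{\rm pref}=\frac{\epsilon_N^\star}{\Delta}\Bigl(4N^2+16\sum_{m=1}^{N-1}m^2\Bigr)^{1/2}=\frac{2\epsilon_N^\star}{\Delta}\sqrt{N^2+\tfrac23N(N-1)(2N-1)},$$ and, as $N\to\infty$ with $\mu,L$ fixed, $$A_N^{\rm pref}=\frac{4}{\sqrt3}\,\frac{N^{3/2}}{\Delta}\,\epsilon_N^\star\,(1+o(1)).$$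
   Context: $T_k,U_k$ are the Chebyshev polynomials of the first and second kind. Put $\Delta=L-\mu$, $\eta=\frac{L+\mu}{L-\mu}>1$, $z(\lambda)=\eta-\frac{2\lambda}{\Delta}$, $\epsilon_N^\star=1/|T_N(\eta)|$, and $\beta_t=\frac{T_{t-1}(\eta)}{T_{t+1}(\eta)}$ for $t\ge1$. The prefix-exact Chebyshev recurrence is $x_1=x_0-\frac{2}{L+\mu}\nabla f(x_0)$ and, for $1\le t\le N-1$, $x_{t+1}=x_t+\beta_t(x_t-x_{t-1})-(1+\beta_t)\frac{2}{L+\mu}\nabla f(x_t)$. First-variation kernel of a two-term recurrence. For a recurrence $x_1=a_0x_0-\gamma_0\nabla f(x_0)$, $x_{t+1}=a_tx_t+b_tx_{t-1}-\gamma_t\nabla f(x_t)$ ($1\le t\le N-1$), set $b_0=0$, let $e_1=(1,0)^\top\in\mathbb R^2$, and $$C_t(\lambda)=\begin{pmatrix}a_t-\gamma_t\lambda & b_t\\ 1&0\end{pmatrix},\qquad 0\le t\le N-1.$$ The kernel is $$K_s(\lambda,\nu)=-\,\gamma_s\; e_1^\top C_{N-1}(\lambda)\cdots C_{s+1}(\lambda)\,e_1\; e_1^\top C_{s-1}(\nu)\cdots C_0(\nu)\,e_1,\qquad 0\le s\le N-1,$$ with empty products equal to the identity. (It is the coefficient with which a Hessian perturbation at time $s$, mapping the $\nu$-eigenspace to the $\lambda$-eigenspace, enters the first variation of the output $x_N$.) The first-order Hessian-drift gain is $$A_N=\sup_{\lambda,\nu\in[\mu,L]}\Bigl(\sum_{s=0}^{N-1}|K_s(\lambda,\nu)|^2\Bigr)^{1/2}.$$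 $K_s^{\rm pref}$ and $A_N^{\rm pref}$ denote these quantities for the prefix-exact Chebyshev recurrence. *)

(* Defs.v *)
From mathcomp Require Import all_boot all_order all_algebra.
From mathcomp Require Import all_classical all_reals all_analysis.

Set Implicit Arguments.
Unset Strict Implicit.
Unset Printing Implicit Defensive.

Import Order.TTheory GRing.Theory Num.Theory.
Import numFieldNormedType.Exports.

Local Open Scope classical_set_scope.
Local Open Scope ring_scope.

Fixpoint chebT (R : realType) (n : nat) : {poly R} :=
  if n is m.+1 then
    if m is k.+1 then 2%:R *: ('X * chebT R m) - chebT R k else 'X
  else 1.

Fixpoint chebU (R : realType) (n : nat) : {poly R} :=
  if n is m.+1 then
    if m is k.+1 then 2%:R *: ('X * chebU R m) - chebU R k else 2%:R *: 'X
  else 1.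

(** Coefficients [a_t], [b_t], [gamma_t] of a two-term recurrence.  The value
    [b_0] never enters the iterates and is replaced by [0] in [step_mx]. *)
Record two_term (R : realType) := TwoTerm {
  coef_a : nat -> R;
  coef_b : nat -> R;
  coef_g : nat -> R
}.

Definition two_term_iterates (R : realType) (V : lmodType R)
    (c : two_term R) (grad : V -> V) (N : nat) (x : nat -> V) : Prop :=
  x 1%N = coef_a c 0 *: x 0%N - coef_g c 0 *: grad (x 0%N) /\
  forall t : nat, (1 <= t <= N - 1)%N ->
    x t.+1 = coef_a c t *: x t + coef_b c t *: x t.-1 - coef_g c t *: grad (x t).

Definition step_mx (R : realType) (c : two_term R) (t : nat) (l : R) : 'M[R]_2 :=
  \matrix_(i < 2, j < 2)
    if i == 0 then
      if j == 0 then coef_a c t - coef_g c t * l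
      else if t == 0%N then 0 else coef_b c t
    else (j == 0)%:R.

(** [C_{n-1}(l) *m ... *m C_m(l)]; the factors do not commute, and the index
    decreases from left to right. *)
Definition step_prod (R : realType) (c : two_term R) (m n : nat) (l : R) :
    'M[R]_2 :=
  \prod_(t <- rev (index_iota m n)) step_mx c t l.

Definition basis1 (R : realType) : 'cV[R]_2 := delta_mx 0 0.

Definition fv_kernel (R : realType) (c : two_term R) (N s : nat) (l v : R) : R :=
  - coef_g c s * ((basis1 R)^T *m step_prod c s.+1 N l *m basis1 R) 0 0
               * ((basis1 R)^T *m step_prod c 0 s v *m basis1 R) 0 0.

Definition drift_gain (R : realType) (mu L : R) (c : two_term R) (N : nat) : R :=
  sup [set Num.sqrt (\sum_(s < N) `|fv_kernel c N s l v| ^+ 2)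
      | l in `[mu, L] & v in `[mu, L]].

Definition Delta (R : realType) (mu L : R) : R := L - mu.

Definition eta (R : realType) (mu L : R) : R := (L + mu) / (L - mu).

Definition zmap (R : realType) (mu L l : R) : R :=
  eta mu L - 2%:R * l / Delta mu L.

Definition eps_star (R : realType) (mu L : R) (N : nat) : R :=
  1 / `|(chebT R N).[eta mu L]|.

Definition momentum (R : realType) (mu L : R) (t : nat) : R :=
  (chebT R t.-1).[eta mu L] / (chebT R t.+1).[eta mu L].

Definition prefix_exact (R : realType) (mu L : R) : two_term R := {|
  coef_a := fun t => if t == 0%N then 1 else 1 + momentum mu L t;
  coef_b := fun t => if t == 0%N then 0 else - momentum mu L t;
  coef_g := fun t => if t == 0%N then 2%:R / (L + mu)
                     else (1 + momentum mu L t) * (2%:R / (L + mu))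
|}.

(** These coefficients are those of the prefix-exact Chebyshev recurrence in
    its momentum form. *)
Lemma prefix_exact_iteratesE (R : realType) (mu L : R) (V : lmodType R)
    (grad : V -> V) (N : nat) (x : nat -> V) :
  two_term_iterates (prefix_exact mu L) grad N x <->
  (x 1%N = x 0%N - (2%:R / (L + mu)) *: grad (x 0%N) /\
   forall t : nat, (1 <= t <= N - 1)%N ->
     x t.+1 = x t + momentum mu L t *: (x t - x t.-1)
              - ((1 + momentum mu L t) * (2%:R / (L + mu))) *: grad (x t)).
Proof.
have E t : (1 <= t)%N ->
    coef_a (prefix_exact mu L) t *: x t + coef_b (prefix_exact mu L) t *: x t.-1
    = x t + momentum mu L t *: (x t - x t.-1).
  by case: t => // t _; rewrite /= scalerDl scale1r scaleNr scalerBr addrA.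
split=> -[h0 h]; (split; first by move: h0; rewrite /= scale1r).
  by move=> t ht; rewrite h // E; case: t ht.
by move=> t ht; rewrite h // E; case: t ht.
Qed.

(* Main.v *)
(** Let z(l) = eta - 2 l / Delta.  Since 1 + beta_t = 2 eta T_t(eta) / T_{t+1}(eta),
    one has a_t - gamma_t l = 2 z(l) T_t(eta) / T_{t+1}(eta), so that the
    recurrence is the three-term Chebyshev recurrence rescaled by T_t(eta).
    Started at time 0 it yields T_s(z(v)) / T_s(eta); started at time s+1 from
    the state (1, 0) it yields T_{s+1}(eta) / T_N(eta) U_{N-s-1}(z(l)).  As z
    maps [mu, L] into [-1, 1], where |T_n| <= 1 and |U_n| <= n + 1 with equality
    at 1 = z(mu), all the summands of the gain are maximal at l = v = mu. *)

Require Import Defs.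
From mathcomp Require Import all_boot all_order all_algebra.
From mathcomp Require Import all_classical all_reals all_analysis.
From mathcomp Require Import ring lra zify.

Set Implicit Arguments.
Unset Strict Implicit.
Unset Printing Implicit Defensive.

Import Order.TTheory GRing.Theory Num.Theory.
Import numFieldNormedType.Exports.

Local Open Scope classical_set_scope.
Local Open Scope ring_scope.

(** * Chebyshev polynomials at real points: recurrences, bounds, values at 1 *)

Lemma horner_chebTSS (R : realType) (n : nat) (x : R) :
  (chebT R n.+2).[x] = 2 * x * (chebT R n.+1).[x] - (chebT R n).[x].
Proof.
have -> : chebT R n.+2 = 2 *: ('X * chebT R n.+1) - chebT R n by [].
by rewrite hornerD hornerN hornerZ hornerM hornerX mulrA.
Qed.

Lemma horner_chebUSS (R : realType) (n : nat) (x : R) :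
  (chebU R n.+2).[x] = 2 * x * (chebU R n.+1).[x] - (chebU R n).[x].
Proof.
have -> : chebU R n.+2 = 2 *: ('X * chebU R n.+1) - chebU R n by [].
by rewrite hornerD hornerN hornerZ hornerM hornerX mulrA.
Qed.

Lemma horner_chebT0x (R : realType) (x : R) : (chebT R 0).[x] = 1.
Proof. by rewrite hornerC. Qed.

Lemma horner_chebT1x (R : realType) (x : R) : (chebT R 1).[x] = x.
Proof. by rewrite hornerX. Qed.

Lemma horner_chebU0x (R : realType) (x : R) : (chebU R 0).[x] = 1.
Proof. by rewrite hornerC. Qed.

Lemma horner_chebU1x (R : realType) (x : R) : (chebU R 1).[x] = 2 * x.
Proof. by rewrite hornerZ hornerX. Qed.

Definition horner_cheb01 :=
  (horner_chebT0x, horner_chebT1x, horner_chebU0x, horner_chebU1x).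

Arguments chebT : simpl never.
Arguments chebU : simpl never.

(** For [x = cos t] these are the addition formulas for [sin ((n+2) t)] and [cos ((n+2) t)]. They
    are proved jointly because the induction step for either one draws on both. *)
Lemma horner_chebTU (R : realType) (n : nat) (x : R) :
  (chebU R n.+1).[x] = x * (chebU R n).[x] + (chebT R n.+1).[x] /\
  (chebT R n.+2).[x] = x * (chebT R n.+1).[x] - (1 - x ^+ 2) * (chebU R n).[x].
Proof.
elim: n => [|n [IHU IHT]]; first by rewrite horner_chebTSS !horner_cheb01; split; ring.
have EU : (chebU R n.+2).[x] = x * (chebU R n.+1).[x] + (chebT R n.+2).[x].
  by rewrite horner_chebUSS IHT IHU; ring.
split=> //; rewrite horner_chebTSS IHT IHU; ring.
Qed.

(** The Pell form of [cos^2 + sin^2 = 1]: the step of [horner_chebTU] preserves the quadratic form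
    [T^2 + (1 - x^2) U^2]. *)
Lemma horner_cheb_pell (R : realType) (n : nat) (x : R) :
  (chebT R n.+1).[x] ^+ 2 + (1 - x ^+ 2) * (chebU R n).[x] ^+ 2 = 1.
Proof.
elim: n => [|n IHn]; first by rewrite !horner_cheb01; ring.
have [-> ->] := horner_chebTU n x; rewrite -[RHS]IHn; ring.
Qed.

Lemma horner_chebT_norm_le1 (R : realType) (n : nat) (x : R) :
  `|x| <= 1 -> `|(chebT R n).[x]| <= 1.
Proof.
move=> x1; have x21 : 0 <= 1 - x ^+ 2 by rewrite subr_ge0 -real_normK ?num_real// expr_le1.
case: n => [|n]; first by rewrite horner_cheb01 normr1.
rewrite -(@expr_le1 _ 2)// real_normK ?num_real// -(horner_cheb_pell n x).
by rewrite lerDl mulr_ge0 // sqr_ge0.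
Qed.

(** By [U_{n+1} = x U_n + T_{n+1}], each increment of the degree adds at most [1] to the bound. *)
Lemma horner_chebU_norm_le (R : realType) (n : nat) (x : R) :
  `|x| <= 1 -> `|(chebU R n).[x]| <= n.+1%:R.
Proof.
move=> x1; elim: n => [|n IHn]; first by rewrite horner_cheb01 normr1.
have [-> _] := horner_chebTU n x; rewrite -[n.+2]addn1 natrD.
apply: le_trans (ler_normD _ _) _; apply: lerD; last exact: horner_chebT_norm_le1.
by rewrite normrM -[leRHS]mul1r ler_pM.
Qed.

Lemma horner_chebT1 (R : realType) (n : nat) : (chebT R n).[1] = 1.
Proof.
suff [] : (chebT R n).[1] = 1 /\ (chebT R n.+1).[1] = 1 by [].
elim: n => [|n [IH1 IH2]]; first by rewrite !horner_cheb01.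
by split=> //; rewrite horner_chebTSS IH1 IH2; ring.
Qed.

Lemma horner_chebU1 (R : realType) (n : nat) : (chebU R n).[1] = n.+1%:R.
Proof.
elim: n => [|n IHn]; first by rewrite horner_cheb01.
by have [-> _] := horner_chebTU n (1 : R); rewrite IHn horner_chebT1 -natr1 -[in RHS]natr1; ring.
Qed.

Lemma horner_chebT_ge1 (R : realType) (n : nat) (x : R) :
  1 <= x -> 1 <= (chebT R n).[x].
Proof.
(* Monotonicity in [n] is carried along: since [2 x >= 2], the increments [T_{n+1} - T_n] stay
   nonnegative. *)
move=> x1; suff [] : 1 <= (chebT R n).[x] /\ (chebT R n).[x] <= (chebT R n.+1).[x] by [].
elim: n => [|n [IH1 IH2]]; first by rewrite !horner_cheb01.
split; first exact: le_trans IH2.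
rewrite horner_chebTSS; nra.
Qed.

(** * The affine change of variable from [[mu, L]] to [[-1, 1]] *)

Lemma eta_gt1 (R : realType) (mu L : R) : 0 < mu -> mu < L -> 1 < eta mu L.
Proof. by move=> mu0 muL; rewrite /eta ltr_pdivlMr ?subr_gt0 //; lra. Qed.

Lemma zmap_mu (R : realType) (mu L : R) : mu < L -> zmap mu L mu = 1.
Proof. by move=> muL; rewrite /zmap /eta /Delta; field; rewrite subr_eq0 gt_eqF. Qed.

Lemma zmap_norm_le1 (R : realType) (mu L l : R) :
  mu < L -> l \in `[mu, L] -> `|zmap mu L l| <= 1.
Proof.
move=> muL; rewrite in_itv /= => /andP[mul lL].
have D0 : 0 < L - mu by rewrite subr_gt0.
have -> : zmap mu L l = (L + mu - 2 * l) / (L - mu).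
  by rewrite /zmap /eta /Delta; field; rewrite gt_eqF.
by rewrite ler_norml ler_pdivlMr // ler_pdivrMr //; apply/andP; split; lra.
Qed.

(** * Products of step matrices *)

Lemma step_prodnn (R : realType) (c : two_term R) (m : nat) (l : R) :
  step_prod c m m l = 1.
Proof. by rewrite /step_prod /index_iota subnn big_nil. Qed.

Lemma step_prodS (R : realType) (c : two_term R) (m n : nat) (l : R) :
  (m <= n)%N -> step_prod c m n.+1 l = step_mx c n l *m step_prod c m n l.
Proof.
move=> mn; rewrite /step_prod /index_iota subSn // -[(n - m).+1]addn1 iotaD cats1 rev_rcons.
by rewrite subnKC // big_cons.
Qed.

(** The kernel only reads the [(0,0)] entries of products, and their recursion closes on the first
    column, whose lower entry is the previous upper one. *)
Lemma step_prodS00 (R : realType) (c : two_term R) (m n : nat) (l : R) :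
  (m <= n)%N ->
  step_prod c m n.+1 l 0 0
  = (coef_a c n - coef_g c n * l) * step_prod c m n l 0 0
    + (if n == 0%N then 0 else coef_b c n) * step_prod c m n l 1 0.
Proof.
move=> mn; rewrite step_prodS // mxE big_ord_recl big_ord1 !mxE /=.
by congr (_ + _ * step_prod _ _ _ _ _ _); apply: val_inj.
Qed.

Lemma step_prodS10 (R : realType) (c : two_term R) (m n : nat) (l : R) :
  (m <= n)%N -> step_prod c m n.+1 l 1 0 = step_prod c m n l 0 0.
Proof.
move=> mn; rewrite step_prodS // mxE big_ord_recl big_ord1 !mxE /=.
by rewrite mul1r mul0r addr0.
Qed.

Lemma fv_kernelE (R : realType) (c : two_term R) (N s : nat) (l v : R) :
  fv_kernel c N s l v
  = - coef_g c s * step_prod c s.+1 N l 0 0 * step_prod c 0 s v 0 0.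
Proof.
have E (A : 'M[R]_2) : ((basis1 R)^T *m A *m basis1 R) 0 0 = A 0 0.
  by rewrite /basis1 trmx_delta -rowE -colE !mxE.
by rewrite /fv_kernel !E.
Qed.

(** * The kernel of the prefix-exact recurrence *)

Section PrefixExact.
Context (R : realType) (mu L : R) (mu_gt0 : 0 < mu) (mu_lt_L : mu < L).
Local Notation Te n := (chebT R n).[eta mu L].
Local Notation pe := (prefix_exact mu L).
Local Notation z := (zmap mu L).

Lemma chebT_eta_gt0 n : 0 < Te n.
Proof. by apply: lt_le_trans (horner_chebT_ge1 _ (ltW (eta_gt1 mu_gt0 mu_lt_L))). Qed.

Let Te_neq0 n : Te n != 0. Proof. by rewrite gt_eqF ?chebT_eta_gt0. Qed.
Let D_neq0 : L - mu != 0. Proof. by rewrite gt_eqF ?subr_gt0. Qed.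
Let S_neq0 : L + mu != 0. Proof. by rewrite gt_eqF // addr_gt0 // (lt_trans mu_gt0). Qed.

Let momentumE n : 1 + momentum mu L n.+1 = 2 * eta mu L * Te n.+1 / Te n.+2.
Proof.
rewrite /momentum; have := horner_chebTSS n (eta mu L); rewrite -[n.+1.-1]/n => E.
apply: (mulIf (Te_neq0 n.+2)); rewrite mulrDl !divfK // E; ring.
Qed.

Lemma prefix_exact_g0 : coef_g pe 0 = 2 / (Delta mu L * Te 1).
Proof. by rewrite /= horner_cheb01 /eta /Delta; field; apply/andP. Qed.

(** In the kernel at time [n.+1], the numerator [Te n.+1] cancels the denominator of the prefix
    product, and [Te n.+2] cancels the numerator of the suffix product. *)
Lemma prefix_exact_gS n : coef_g pe n.+1 = 4 * Te n.+1 / (Delta mu L * Te n.+2).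
Proof.
rewrite /= momentumE.
(* The Chebyshev values are generalized first, so that unfolding [eta] does not reach inside them
   and [field] sees atoms. *)
move: (Te _) (Te _) (Te_neq0 n.+2) => x y y0; rewrite /eta /Delta; field.
by rewrite ?D_neq0 ?S_neq0 ?y0.
Qed.

(** Unlike at later times, [z l] carries no factor [2]; this is why prefix products start with
    [T_1 = x] and suffix products with [U_1 = 2 x]. *)
Lemma prefix_exact_ag0 l : coef_a pe 0 - coef_g pe 0 * l = z l / Te 1.
Proof.
rewrite /= horner_cheb01 /zmap /eta /Delta; field.
by rewrite ?D_neq0 ?S_neq0.
Qed.

Lemma prefix_exact_agS n l :
  coef_a pe n.+1 - coef_g pe n.+1 * l = 2 * z l * Te n.+1 / Te n.+2.
Proof.
rewrite prefix_exact_gS /= momentumE /zmap.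
move: (Te _) (Te _) (Te_neq0 n.+2) => x y y0; rewrite /eta /Delta; field.
by rewrite ?D_neq0 ?S_neq0 ?y0.
Qed.

(** Both state components are tracked. The induction starts after one step because the empty product
    has lower entry [0], while the pattern begins with [T_0 = 1]. *)
Lemma step_prod_prefix s v :
  step_prod pe 0 s.+1 v 0 0 = (chebT R s.+1).[z v] / Te s.+1 /\
  step_prod pe 0 s.+1 v 1 0 = (chebT R s).[z v] / Te s.
Proof.
elim: s => [|s [IH0 IH1]].
  rewrite step_prodS00 // step_prodS10 // step_prodnn prefix_exact_ag0 !mxE /=.
  have := Te_neq0 1; rewrite !horner_cheb01 => e0; split; last by rewrite divr1.
  by field.
rewrite step_prodS10 // step_prodS00 // prefix_exact_agS IH0 IH1; split=> //=.
rewrite /momentum /= [in RHS]horner_chebTSS.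
have := Te_neq0 s; have := Te_neq0 s.+1; have := Te_neq0 s.+2.
move: (Te s) (Te _) (Te _) => x y w w0 y0 x0; field.
by rewrite x0 y0 w0.
Qed.

(** The state [(1, 0)] plays the role of [(U_0, U_{-1})]. Starting at [m.+1] keeps every factor away
    from the exceptional coefficients at time 0. *)
Lemma step_prod_suffix m k l :
  step_prod pe m.+1 (m.+1 + k.+1) l 0 0
    = Te m.+1 / Te (m.+1 + k.+1) * (chebU R k.+1).[z l] /\
  step_prod pe m.+1 (m.+1 + k.+1) l 1 0
    = Te m.+1 / Te (m.+1 + k) * (chebU R k).[z l].
Proof.
elim: k => [|k [IH0 IH1]].
  rewrite addn1 addn0 step_prodS10 // step_prodS00 // step_prodnn.
  rewrite prefix_exact_agS !mxE /= !horner_cheb01.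
  have := Te_neq0 m.+1; have := Te_neq0 m.+2.
  by move: (Te _) (Te _) => x y y0 x0; split; field.
have mk : (m.+1 <= m.+1 + k.+1)%N by exact: leq_addr.
rewrite addnS (step_prodS10 _ _ mk) (step_prodS00 _ _ mk) IH0 IH1; split=> //.
rewrite !addnS !addSn prefix_exact_agS /= /momentum /= horner_chebUSS.
have := Te_neq0 (m + k).+1; have := Te_neq0 (m + k).+2; have := Te_neq0 (m + k).+3.
move: (Te (_ + _).+1) (Te (_ + _).+2) (Te (_ + _).+3) => x y w w0 y0 x0; field.
by rewrite x0 y0 w0.
Qed.

Let suffix_kernel N s l : (s < N)%N ->
  step_prod pe s.+1 N l 0 0 = Te s.+1 / Te N * (chebU R (N - s.+1)).[z l].
Proof.
(* At the last time [s = N - 1] the product is empty, in agreement with [U_0 = 1]. *)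
move=> sN; rewrite -{1 2}(subnKC sN); case: (N - s.+1)%N => [|k].
  by rewrite addn0 step_prodnn mxE divff // horner_cheb01 mulr1.
by have [] := step_prod_suffix s k l.
Qed.

Lemma fv_kernel_prefix0 N l v : (1 <= N)%N ->
  fv_kernel pe N 0 l v
  = - (2 / (Delta mu L * Te N)) * (chebU R (N - 1)).[z l].
Proof.
move=> N1; rewrite fv_kernelE suffix_kernel // step_prodnn prefix_exact_g0 !mxE /=.
have := Te_neq0 1; have := Te_neq0 N.
move: (Te _) (Te _) => x y y0 x0; rewrite /Delta; field.
by rewrite x0 y0 D_neq0.
Qed.

Lemma fv_kernel_prefixS N s l v : (1 <= s <= N - 1)%N ->
  fv_kernel pe N s l v
  = - (4 / (Delta mu L * Te N)) * (chebU R (N - s - 1)).[z l] * (chebT R s).[z v].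
Proof.
case: s => [//|s] /andP[_ sN].
have {}sN : (s.+1 < N)%N by lia.
rewrite fv_kernelE suffix_kernel // (step_prod_prefix s v).1 prefix_exact_gS.
have -> : (N - s.+1 - 1 = N - s.+2)%N by lia.
have := Te_neq0 s.+1; have := Te_neq0 s.+2; have := Te_neq0 N.
move: (Te _) (Te _) (Te _) => x y w w0 y0 x0; rewrite /Delta; field.
by rewrite x0 y0 w0 D_neq0.
Qed.

End PrefixExact.

(** * The gain as an attained supremum, and its closed form *)

Lemma sup_eq_max (R : realType) (A : set R) (M : R) :
  A M -> ubound A M -> sup A = M.
Proof.
move=> AM ubM; apply/eqP; rewrite eq_le; apply/andP; split.
  by apply: ge_sup => //; exists M.
by apply: ub_le_sup => //; exists M.
Qed.

(** With [N = n.+1] and [s = i.+1], the value [U_{N-s-1}(1)] is [n - i], so the kernel produces the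
    squares in decreasing order. *)
Lemma sum_sqr_rev (R : realType) (n : nat) :
  \sum_(1 <= m < n.+1) m%:R ^+ 2 = \sum_(i < n) (n - i)%:R ^+ 2 :> R.
Proof.
rewrite big_add1 big_mkord (reindex_inj rev_ord_inj) /=.
by apply: eq_bigr => i _; rewrite subnSK.
Qed.

Lemma sum_sqr (R : realType) (n : nat) :
  \sum_(1 <= m < n.+1) m%:R ^+ 2
  = n%:R * (n%:R + 1) * (2 * n%:R + 1) / 6 :> R.
Proof.
elim: n => [|n IHn]; first by rewrite big_geq // !mul0r.
by rewrite big_nat_recr //= IHn -natr1; field.
Qed.

Lemma drift_gain_prefix (R : realType) (mu L : R) (N : nat) :
  0 < mu -> mu < L -> (1 <= N)%N ->
  drift_gain mu L (prefix_exact mu L) N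
  = eps_star mu L N / Delta mu L
    * Num.sqrt (4 * N%:R ^+ 2 + 16 * \sum_(1 <= m < N) m%:R ^+ 2).
Proof.
case: N => [|n] // mu0 muL _.
set c := eps_star mu L n.+1 / Delta mu L.
have D0 : 0 < Delta mu L by rewrite /Delta subr_gt0.
have T0 := chebT_eta_gt0 mu0 muL n.+1.
have c0 : 0 <= c by rewrite divr_ge0 ?ltW // /eps_star divr_gt0 // normr_gt0 gt_eqF.
have cE : (Delta mu L * (chebT R n.+1).[eta mu L])^-1 = c.
  rewrite /c /eps_star gtr0_norm //; field; by rewrite !gt_eqF.
(* The kernel has constant [2] at [s = 0] and [4] afterwards, hence the weights [4] and [16] once
   [c ^+ 2] is factored out. *)
have KE (l v : R) : \sum_(s < n.+1) `|fv_kernel (prefix_exact mu L) n.+1 s l v| ^+ 2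
    = c ^+ 2 * (4 * `|(chebU R n).[zmap mu L l]| ^+ 2
        + 16 * \sum_(i < n) (`|(chebU R (n - i.+1)).[zmap mu L l]|
                             * `|(chebT R i.+1).[zmap mu L v]|) ^+ 2).
  rewrite big_ord_recl fv_kernel_prefix0 // subn1 /= mulrDr; congr (_ + _).
    rewrite !normrM normrN cE normrM (ger0_norm c0) normr_nat; ring.
  rewrite mulrA big_distrr; apply: eq_bigr => i _.
  rewrite fv_kernel_prefixS //; last by have := ltn_ord i; rewrite /bump; lia.
  rewrite /bump /= add1n.
  have -> : (n.+1 - i.+1 - 1 = n - i.+1)%N by lia.
  rewrite !normrM normrN cE normrM (ger0_norm c0) normr_nat; ring.
have sqrtE (x : R) : Num.sqrt (c ^+ 2 * x) = c * Num.sqrt x.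
  by rewrite sqrtrM ?sqr_ge0 // sqrtr_sqr ger0_norm.
rewrite -sqrtE sum_sqr_rev; apply: sup_eq_max.
  have muI : mu \in `[mu, L] by rewrite in_itv /= lexx ltW.
  exists mu => //; exists mu => //; rewrite KE zmap_mu // horner_chebU1 normr_nat.
  congr (Num.sqrt (_ * (_ + _ * _))); apply: eq_bigr => i _.
  by rewrite horner_chebU1 horner_chebT1 normr_nat normr1 mulr1 subnSK.
move=> _ [l lI [v vI <-]]; rewrite KE; apply: ler_wsqrtr.
have zl := zmap_norm_le1 muL lI; have zv := zmap_norm_le1 muL vI.
(* The comparison is made summand by summand, since all the bounds are attained at the same
   point. *)
rewrite ler_wpM2l ?sqr_ge0 // lerD // ler_wpM2l //.
  by rewrite lerXn2r ?nnegrE // horner_chebU_norm_le.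
apply: ler_sum => i _; rewrite lerXn2r ?nnegrE ?mulr_ge0 //.
rewrite -[leRHS]mulr1 ler_pM // ?horner_chebT_norm_le1 //.
by rewrite -[X in X%:R]subnSK // horner_chebU_norm_le.
Qed.

Lemma drift_gain_prefix_closed (R : realType) (mu L : R) (N : nat) :
  0 < mu -> mu < L -> (1 <= N)%N ->
  drift_gain mu L (prefix_exact mu L) N
  = 2 * eps_star mu L N / Delta mu L
    * Num.sqrt (N%:R ^+ 2 + 2 / 3 * N%:R * (N%:R - 1) * (2 * N%:R - 1)).
Proof.
move=> mu0 muL N1; rewrite drift_gain_prefix //.
case: N N1 => [|n] // _; rewrite sum_sqr -[n.+1%:R]natr1.
have -> : 4 * (n%:R + 1) ^+ 2 + 16 * (n%:R * (n%:R + 1) * (2 * n%:R + 1) / 6)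
   = 2 ^+ 2 * ((n%:R + 1) ^+ 2 + 2 / 3 * (n%:R + 1) * (n%:R + 1 - 1)
               * (2 * (n%:R + 1) - 1)) :> R by field.
by rewrite sqrtrM ?sqr_ge0 // sqrtr_sqr ger0_norm //; ring.
Qed.

(** * Asymptotics for a large horizon *)

Lemma sqrt_cubic_asymptotic (R : realType) (x : R) : 0 < x ->
  Num.sqrt (x ^+ 2 + 2 / 3 * x * (x - 1) * (2 * x - 1))
  = 2 / Num.sqrt 3 * x `^ (3 / 2)
    * Num.sqrt (1 - 3 / 4 * x^-1 + 1 / 2 * x^-1 ^+ 2).
Proof.
move=> x0; have s3 : (0 : R) < Num.sqrt 3 by rewrite sqrtr_gt0.
have P2 : (x `^ (3 / 2)) ^+ 2 = x ^+ 3.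
  by rewrite -!powR_mulrn ?powR_ge0 ?ltW // -powRrM divfK.
have -> : 2 / Num.sqrt 3 * x `^ (3 / 2) = Num.sqrt (4 / 3 * x ^+ 3).
  rewrite -[LHS]ger0_norm ?mulr_ge0 ?powR_ge0 ?invr_ge0 ?ltW // -sqrtr_sqr.
  by rewrite !exprMn P2 exprVn sqr_sqrtr //; congr (Num.sqrt (_ / _ * _)); ring.
(* The radicand expands to [4/3 x^3 - x^2 + 2/3 x], from which the leading term [4/3 x^3] is
   factored out. *)
rewrite -sqrtrM; first by congr Num.sqrt; field; rewrite gt_eqF.
by rewrite mulr_ge0 ?divr_ge0 ?exprn_ge0 ?ltW.
Qed.

Lemma cvg_asymptotic_factor (R : realType) :
  (fun n : nat => Num.sqrt (1 - 3 / 4 * n%:R^-1 + 1 / 2 * n%:R^-1 ^+ 2) : R)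
    @ \oo --> (1 : R).
Proof.
have inv0 : (fun n : nat => n%:R^-1 : R) @ \oo --> (0 : R).
  (* The harmonic sequence is indexed as [1 / (n + 1)], hence the shift. *)
  by rewrite -(cvg_shiftS _); exact: cvg_harmonic.
have q1 : (fun n : nat => 1 - 3 / 4 * n%:R^-1 + 1 / 2 * n%:R^-1 ^+ 2 : R)
    @ \oo --> (1 : R).
  rewrite [X in _ --> X](_ : 1 = 1 - 3 / 4 * 0 + 1 / 2 * (0 * 0)); last by ring.
  under eq_fun do rewrite expr2.
  apply: cvgD; last by apply: cvgM; [exact: cvg_cst|exact: cvgM].
  by apply: cvgB; [exact: cvg_cst|apply: cvgM => //; exact: cvg_cst].
rewrite -[X in _ --> X](@sqrtr1 R).
exact: continuous_cvg (@sqrt_continuous R 1) q1.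
Qed.

Theorem theorem2p2 (R : realType) (mu L : R) (mu_gt0 : 0 < mu) (mu_lt_L : mu < L) :
  (forall N : nat, (1 <= N)%N ->
    [/\ forall l v : R, l \in `[mu, L] -> v \in `[mu, L] ->
          fv_kernel (prefix_exact mu L) N 0 l v
          = - (2%:R / (Delta mu L * (chebT R N).[eta mu L]))
            * (chebU R (N - 1)).[zmap mu L l],
        forall s : nat, (1 <= s <= N - 1)%N ->
        forall l v : R, l \in `[mu, L] -> v \in `[mu, L] ->
          fv_kernel (prefix_exact mu L) N s l v
          = - (4%:R / (Delta mu L * (chebT R N).[eta mu L]))
            * (chebU R (N - s - 1)).[zmap mu L l] * (chebT R s).[zmap mu L v],
        drift_gain mu L (prefix_exact mu L) N
        = eps_star mu L N / Delta mu L
          * Num.sqrt (4%:R * N%:R ^+ 2 + 16%:R * \sum_(1 <= m < N) m%:R ^+ 2)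
      & drift_gain mu L (prefix_exact mu L) N
        = 2%:R * eps_star mu L N / Delta mu L
          * Num.sqrt (N%:R ^+ 2
                      + 2%:R / 3%:R * N%:R * (N%:R - 1) * (2%:R * N%:R - 1))]) /\
  (exists2 e : nat -> R, e @ \oo --> (0 : R) &
    \forall N \near \oo,
      drift_gain mu L (prefix_exact mu L) N
      = 4%:R / Num.sqrt 3%:R * (N%:R `^ (3%:R / 2%:R) / Delta mu L)
        * eps_star mu L N * (1 + e N)).
Proof.
split=> [N N1|].
  split=> [l v _ _|s sN l v _ _||].
  - exact: fv_kernel_prefix0.
  - exact: fv_kernel_prefixS.
  - exact: drift_gain_prefix.
  - exact: drift_gain_prefix_closed.
(* This [e] is the exact relative error, so the identity holds for every [N >= 1], not merely
   eventually. *)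
exists (fun N => Num.sqrt (1 - 3 / 4 * N%:R^-1 + 1 / 2 * N%:R^-1 ^+ 2) - 1).
  rewrite -(subrr (1 : R)); apply: cvgB; last exact: cvg_cst.
  exact: cvg_asymptotic_factor.
near=> N.
have N1 : (1 <= N)%N by near: N; exact: nbhs_infty_ge.
rewrite drift_gain_prefix_closed // sqrt_cubic_asymptotic ?ltr0n //; ring.
Unshelve. all: by end_near.
Qed.
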